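(* Let $P$, $T$, $B$, $D$ be the Petersen, Triplex, Basket and dodecahedral graphs, and let $Q=P/e$ for an edge $e$ of $P$. Each of $P$, $T$, and $B$ contains $Q$ as a minor. Every jump extension and every cross extension of $D$ contains $Q$ as a minor.
   Context: The graphs are the following simple graphs. Petersen graph $P$: vertex set $\{0,\dots,9\}$; outer cycle $0,1,2,3,4$, inner cycle $5,7,9,6,8$, and spokes joining $i$ to $5+i$ for $0\le i\le4$. It is edge-transitive, so $Q=P/e$ (contraction of $e$) is independent of $e$ up to isomorphism; explicitly $Q$ is isomorphic to the graph on $\{0,\dots,8\}$ with edges $01,03,04,05,12,16,23,27,38,46,47,57,58,68$. Triplex $T$: vertex set $\{0,\dots,11\}$; the $9$-cycle $0,1,\dots,8$ together with three further vertices $9+r$, each adjacent to $r,r+3,r+6$, for $r=0,1,2$. Basket $B$: vertex set $\{0,\dots,11\}$; the $8$-cycle $(0,1,3,8,10,9,11,2)$, the $4$-cycle $(4,5,7,6)$, the edges $\{1,4\},\{2,5\},\{8,6\},\{9,7\}$, and the edges $\{0,10\},\{3,11\}$. Dodecahedron $D$: the generalized Petersen graph $GP(10,2)$ with vertex set $\{0,\dots,19\}$ and, for $0\le i<10$ with indices modulo $10$, edges $\{i,i+1\}$, $\{i,10+i\}$, $\{10+i,10+(i+2)\}$, where $i+1$ and $i+2$ are reduced modulo $10$. It is a $3$-connected planar cubic graph; in its (unique) spherical embedding the facial cycles are twelve pentagons, one of which is $(0,1,2,12,10)$. For a $3$-connected planar graph $H$ with its spherical embedding: a jump extension of $H$ is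 a graph $H+uv$ obtained by adding an edge $uv$ between two vertices $u,v$ such that no facial cycle of $H$ contains both $u$ and $v$. A cross extension of $H$ is a graph $H+u_1v_1+u_2v_2$ obtained by adding two edges, where $u_1,u_2,v_1,v_2$ are distinct and occur in this cyclic order on a facial cycle of $H$. A graph $G$ contains the simple graph $Q$ as a minor if there is a family $(B_x : x\in V(Q))$ of nonempty, pairwise disjoint vertex sets of $G$, each inducing a connected subgraph, such that some edge of $G$ joins $B_x$ and $B_y$ whenever $xy\in E(Q)$. *)

(* Defs.v *)
From mathcomp Require Import all_boot.

Set Implicit Arguments.
Unset Strict Implicit.
Unset Printing Implicit Defensive.

(** * Finite simple graphs *)

Record sgraph := SGraph {
  vertex :> finType;
  adj : rel vertex;
  adj_sym : symmetric adj;
  adj_irrefl : irreflexive adj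
}.

(* The simple graph obtained from an arbitrary relation by forgetting the
   orientation of pairs and discarding loops. *)
Section OfRel.
Variables (T : finType) (r : rel T).
Definition sym_rel : rel T := fun x y => (x != y) && (r x y || r y x).
Lemma sym_rel_sym : symmetric sym_rel.
Proof. by move=> x y; rewrite /sym_rel eq_sym orbC. Qed.
Lemma sym_rel_irrefl : irreflexive sym_rel.
Proof. by move=> x; rewrite /sym_rel eqxx. Qed.
Definition graph_of_rel : sgraph := SGraph sym_rel_sym sym_rel_irrefl.
End OfRel.

Definition edge_graph (n : nat) (s : seq (nat * nat)) : sgraph :=
  graph_of_rel (fun x y : 'I_n => (val x, val y) \in s).

Definition cycle_edges (c : seq nat) : seq (nat * nat) := zip c (rot 1 c).

Definition add_edge (G : sgraph) (u v : G) : sgraph :=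
  graph_of_rel (fun x y : G => adj x y || ((x == u) && (y == v))).

(* G / xy: [None] is the vertex obtained by identifying x and y. *)
Definition contract (G : sgraph) (x y : G) : sgraph :=
  graph_of_rel (fun a b : option {z : G | (z != x) && (z != y)} =>
    match a, b with
    | Some a, Some b => adj (val a) (val b)
    | None, Some b => adj x (val b) || adj y (val b)
    | _, None => false
    end).

(** * Minors *)

Definition connected_in (G : sgraph) (A : {set G}) : Prop :=
  {in A &, forall u v : G,
    connect (fun a b : G => [&& a \in A, b \in A & adj a b]) u v}.

Definition has_minor (G H : sgraph) : Prop :=
  exists B : H -> {set G},
    [/\ forall x, B x != set0,
        forall x y, x != y -> [disjoint B x & B y],
        forall x, connected_in (B x)
      & forall x y, adj x y ->
          exists u v : G, [/\ u \in B x, v \in B y & adj u v]].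

(** * Spherical embeddings *)

Definition darts (G : sgraph) : {set G * G} := [set p | adj p.1 p.2].

(* Face tracing for the cyclic orders [r v] of the neighbours of each v:
   after traversing u -> v, leave v along the successor of u around v. *)
Definition face_step (G : sgraph) (r : G -> seq G) (p : G * G) : G * G :=
  (p.2, next (r p.2) p.1).

(* An embedding of a connected graph in an oriented surface is encoded by its
   rotation system; its faces are the orbits of [face_step] on darts, and the
   surface is the sphere when Euler's formula V + F = E + 2 holds.  (Isolated
   vertices carry no dart, so the graph with one vertex is not covered.) *)
Record spherical_embedding (G : sgraph) := SphericalEmbedding {
  rotation : G -> seq G;
  rotation_uniq : forall v, uniq (rotation v);
  mem_rotation : forall v u, (u \in rotation v) = adj v u;
  embedding_connected : connected_in [set: G];
  embedding_euler :
    #|G| + fcard (face_step rotation) (darts G) = #|darts G|./2 + 2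
}.

(* The face to one side of the dart p, read from p.1.  Since p ranges over all
   darts, every cyclic rotation of a facial cycle is again a facial cycle. *)
Definition facial_cycle (G : sgraph) (M : spherical_embedding G) (c : seq G) :
    Prop :=
  [/\ 2 < size c, ucycle (@adj G) c
    & exists2 p, p \in darts G
               & c = [seq q.1 | q <- orbit (face_step (rotation M)) p]].

Definition jump_extension (H : sgraph) (M : spherical_embedding H)
    (G : sgraph) : Prop :=
  exists u v : H,
    [/\ u != v,
        forall c, facial_cycle M c -> ~ (u \in c /\ v \in c)
      & G = add_edge u v].

Definition add_edges2 (H : sgraph) (u1 v1 u2 v2 : H) : sgraph :=
  @add_edge (add_edge u1 v1) u2 v2.

Definition cross_extension (H : sgraph) (M : spherical_embedding H)
    (G : sgraph) : Prop :=
  exists (c : seq H) (u1 u2 v1 v2 : H),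
    [/\ facial_cycle M c, uniq [:: u1; u2; v1; v2],
        subseq [:: u1; u2; v1; v2] c
      & G = add_edges2 u1 v1 u2 v2].

(** * The graphs *)

Definition Petersen : sgraph :=
  edge_graph 10 (cycle_edges [:: 0; 1; 2; 3; 4]
              ++ cycle_edges [:: 5; 7; 9; 6; 8]
              ++ [seq (i, 5 + i) | i <- iota 0 5]).

Definition Triplex : sgraph :=
  edge_graph 12 (cycle_edges (iota 0 9)
              ++ [seq (9 + r, r + 3 * k) | r <- iota 0 3, k <- iota 0 3]).

Definition Basket : sgraph :=
  edge_graph 12 (cycle_edges [:: 0; 1; 3; 8; 10; 9; 11; 2]
              ++ cycle_edges [:: 4; 5; 7; 6]
              ++ [:: (1, 4); (2, 5); (8, 6); (9, 7)]
              ++ [:: (0, 10); (3, 11)]).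

Definition Dodecahedron : sgraph :=
  edge_graph 20 ([seq (i, i.+1 %% 10) | i <- iota 0 10]
              ++ [seq (i, 10 + i) | i <- iota 0 10]
              ++ [seq (10 + i, 10 + (i + 2) %% 10) | i <- iota 0 10]).

(* [spherical_embedding Dodecahedron] is inhabited, with the expected
   pentagonal face: quantifying over it is not vacuous. *)
Module DodecahedronEmbedding.

Definition Z (k : nat) : Dodecahedron := @Ordinal 20 (k %% 20) (ltn_pmod k (isT : 0 < 20)).
Lemma ZK (i : 'I_20) : Z i = i.
Proof. by apply: val_inj; rewrite /= modn_small. Qed.
Definition drot (v : Dodecahedron) : seq Dodecahedron :=
  let i := val v in map Z
  (if i < 10 then if odd i then [:: (i+9)%%10; i.+1%%10; 10+i] else [:: i.+1%%10; (i+9)%%10; 10+i]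
   else let j := i - 10 in
   if odd i then [:: 10+(j+2)%%10;10+(j+8)%%10; j] else [::10+(j+8)%%10; 10+(j+2)%%10;j]).

Lemma ZE (v : Dodecahedron) : exists2 k, k \in iota 0 20 & v = Z k.
Proof. exists (val v); first by rewrite mem_iota /= add0n ltn_ord. by rewrite ZK. Qed.
Lemma all1 (P : pred Dodecahedron) : all (fun k => P (Z k)) (iota 0 20) -> forall v, P v.
Proof. by move=> /allP H v; case: (ZE v) => k /H ? ->. Qed.
Lemma all2 (P : rel Dodecahedron) : all (fun k => all (fun l => P (Z k) (Z l)) (iota 0 20)) (iota 0 20) -> forall u v, P u v.
Proof. move=> H u v; apply: (all1 (P := P u)). exact: (all1 (P := fun u => all (fun l => P u (Z l)) (iota 0 20))). Qed.

Lemma Duniq v : uniq (drot v).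
Proof. by move: v; apply: all1; vm_compute. Qed.
Lemma Dmem v u : (u \in drot v) = adj v u.
Proof. apply/eqP; move: v u; apply: (all2 (P := fun v u => (u \in drot v) == adj v u)); by vm_compute. Qed.
Lemma Dconn : connected_in [set: Dodecahedron].
Proof.
have E : (fun a b : Dodecahedron => [&& a \in [set: Dodecahedron], b \in [set: Dodecahedron] & adj a b]) =2 @adj Dodecahedron by move=> a b; rewrite !inE.
have S : connect_sym (@adj Dodecahedron) by apply: sym_connect_sym; apply: adj_sym.
have C v : connect (@adj Dodecahedron) (Z 0) v.
  apply/connectP; exists (map Z (if val v < 10 then iota 1 (val v) else rcons (iota 1 (val v - 10)) (val v))).
  - apply: (all1 (P := fun v => path (@adj Dodecahedron) (Z 0) (map Z (if val v < 10 then iota 1 (val v) else rcons (iota 1 (val v - 10)) (val v))))); by vm_compute.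
  - apply/eqP; apply: (all1 (P := fun v => v == last (Z 0) (map Z (if val v < 10 then iota 1 (val v) else rcons (iota 1 (val v - 10)) (val v))))); by vm_compute.
move=> u v _ _; rewrite (eq_connect E); apply: connect_trans (C v). by rewrite S.
Qed.
Local Definition f := @face_step Dodecahedron drot.
Lemma finj : injective f.
Proof. by move=> [a b] [c d] [] /= <- /(can_inj (prev_next (Duniq b))) ->. Qed.
Lemma card_d : #|darts Dodecahedron| = 60.
Proof.
rewrite -sum1_card.
under eq_bigl => p do rewrite inE.
rewrite big_mkcond /=.
rewrite -(pair_bigA _ (fun i j : 'I_20 => if @adj Dodecahedron i j then 1 else 0)) /=.
transitivity (\sum_(i < 20) \sum_(j < 20) (if @adj Dodecahedron (Z i) (Z j) then 1 else 0)).
  by apply: eq_bigr => i _; apply: eq_bigr => j _; rewrite !ZK.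
under eq_bigr => i _ do rewrite -(big_mkord xpredT (fun j => if @adj Dodecahedron (Z i) (Z j) then 1 else 0)).
rewrite -(big_mkord xpredT (fun i => \sum_(0 <= j < 20) (if @adj Dodecahedron (Z i) (Z j) then 1 else 0))).
rewrite unlock. by vm_compute.
Qed.
Lemma ord5 a b : @adj Dodecahedron a b -> order f (a,b) = 5.
Proof.
move=> ab.
have := all2 (P := fun a b => @adj Dodecahedron a b ==> (fcycle f (traject f (a,b) 5) && uniq (traject f (a,b) 5))).
move=> /(_ _ a b) H.
have {H}/H : is_true (all (fun k => all (fun l => @adj Dodecahedron (Z k) (Z l) ==> (fcycle f (traject f (Z k,Z l) 5) && uniq (traject f (Z k,Z l) 5))) (iota 0 20)) (iota 0 20)) by vm_compute.
move/implyP/(_ ab)/andP=> -[h1 h2].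
rewrite (order_cycle h1 h2) ?size_traject //; exact: mem_head.
Qed.
Lemma Deuler : #|Dodecahedron| + fcard f (darts Dodecahedron) = #|darts Dodecahedron|./2 + 2.
Proof.
have H : fcard f (darts Dodecahedron) * 5 = #|darts Dodecahedron|.
  apply: fcard_order_set; first exact: finj.
  - apply/subsetP => -[a b]; rewrite inE /= => h. by rewrite inE; apply/eqP; apply: ord5.
  - apply: intro_closed; first by apply: fconnect_sym; apply: finj.
    move=> [a b] q /eqP <-; rewrite !inE => h.
    have {}h : @adj Dodecahedron a b by [].
    change (is_true (@adj Dodecahedron b (next (drot b) a))); by rewrite -Dmem mem_next Dmem adj_sym.
rewrite card_d in H *.
have -> : fcard f (darts Dodecahedron) = 12 by apply/eqP; rewrite -(eqn_pmul2r (m:=5)) // H.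
by rewrite card_ord.
Qed.
Definition M := SphericalEmbedding Duniq Dmem Dconn Deuler.

Lemma exists_embedding : exists M0 : spherical_embedding Dodecahedron,
  facial_cycle M0 (map Z [:: 0; 1; 2; 12; 10]).
Proof.
exists M; split; [by vm_compute | by vm_compute |].
exists (Z 0, Z 1); first by rewrite inE; vm_compute.
rewrite /orbit -/f ord5; last by vm_compute.
by apply/eqP; vm_compute.
Qed.

End DodecahedronEmbedding.

(* Main.v *)
Require Import Defs.
From mathcomp Require Import all_boot zmodp.

Set Implicit Arguments.
Unset Strict Implicit.
Unset Printing Implicit Defensive.

(** Minors pass along injective edge-preserving maps ([has_minor_mono]), so
    symmetry reduces the theorem to seven explicit models of one nine-vertex
    graph [Q_graph].  The Petersen graph is arc-transitive, and therefore every
    contraction of one of its edges embeds in [Q_graph]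
    ([contract_petersen_minor]).  A model is given by listing its branch sets,
    and whether such a list is a model is decided by evaluation
    ([minor_of_certificate]).

    The spherical embedding of the dodecahedron is arbitrary, so its faces
    first have to be identified.  Euler's formula gives 12 faces for 60 darts.
    A face walk never turns back, because every rotation has length three, so
    girth five makes every face have length at least five.  Hence each face has
    length exactly five and its walk is a 5-cycle ([face_order],
    [facial_cycle_of_dart]).  Two neighbours of a vertex are consecutive in its
    rotation in one of the two orders, so vertices at distance at most two
    always share a face ([cofacial_adj], [cofacial_common_neighbour]).

    A jump therefore joins vertices at distance 3, 4 or 5, and the
    dodecahedron has a symmetry carrying any such ordered pair to a fixed one
    of the same distance ([far_transitive]): three models suffice.  A cross
    lives on a 5-cycle, and all 5-cycles, with a starting point and a
    direction, are equivalent ([pentagon_transitive]).  Starting just after the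
    vertex that is not used by the cross leaves a single cross up to rotating
    its four ends, hence one model ([pentagon_cross_minor]).  The remaining
    three models are those in the Petersen, Triplex and Basket graphs.

    Symmetries are produced by a backtracking search whose results are proved
    to be monomorphisms ([embeddings_mono]). *)

(** * Transporting minors along monomorphisms *)

Definition monomorphism (G H : sgraph) (f : G -> H) : Prop :=
  injective f /\ {homo f : x y / adj x y}.

Lemma has_minor_mono (G H K : sgraph) (f : G -> H) :
  monomorphism f -> has_minor G K -> has_minor H K.
Proof.
move=> [f_inj f_adj] [B [B0 Bdisj Bconn Badj]].
exists (fun x => f @: B x); split=> [x|x y xy|x|x y xy].
- by rewrite imset_eq0.
- by rewrite imset_disjoint ?Bdisj //; apply: in2W.
- move=> _ _ /imsetP[u uB ->] /imsetP[v vB ->].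
  have /connectP[p p_path ->] := Bconn x u v uB vB.
  apply/connectP; exists (map f p); last by rewrite last_map.
  apply: homo_path p_path => a b /and3P[aB bB ab].
  by rewrite !imset_f // f_adj.
- have [u [v [uB vB uv]]] := Badj x y xy.
  by exists (f u), (f v); rewrite !imset_f // f_adj.
Qed.

Lemma add_edge_mono (G H : sgraph) (f : G -> H) (u v : G) :
  monomorphism f -> @monomorphism (add_edge u v) (add_edge (f u) (f v)) f.
Proof.
move=> [f_inj f_adj]; split=> // x y /andP[xy /= xy_adj].
rewrite /= /sym_rel (inj_eq f_inj) xy /= !(inj_eq f_inj).
by case/orP: xy_adj => /orP[/f_adj ->|->]; rewrite ?orbT.
Qed.

Lemma add_edges2_mono (G H : sgraph) (f : G -> H) (u1 v1 u2 v2 : G) :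
  monomorphism f ->
  @monomorphism (add_edges2 u1 v1 u2 v2)
    (add_edges2 (f u1) (f v1) (f u2) (f v2)) f.
Proof. by move=> /(add_edge_mono u1 v1)/add_edge_mono; apply. Qed.

(** The fibre condition says that [f] is injective apart from [f x = f y], so
    [f] factors through a monomorphism from [contract x y] to [K]. *)
Lemma contract_minor (G K H : sgraph) (x y : G) (f : G -> K) :
    f x = f y ->
    (forall a b, a != b -> f a = f b -> a \in [:: x; y]) ->
    (forall a b, adj a b -> f a != f b -> adj (f a) (f b)) ->
  has_minor H K -> has_minor H (contract x y).
Proof.
move=> fxy f_fib f_adj [B [B0 Bdisj Bconn Badj]].
pose g (a : contract x y) : K := if a is Some a then f (val a) else f x.
have g_inj : injective g.
  have f_out (a : {z : G | (z != x) && (z != y)}) b : f (val a) = f b -> val a = b.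
    move=> fab; apply/eqP; apply: contraT => /f_fib/(_ fab).
    by rewrite !inE; case/andP: (valP a) => /negbTE -> /negbTE ->.
  have f_x (a : {z : G | (z != x) && (z != y)}) : f (val a) <> f x.
    by move/f_out => ax; have := valP a; rewrite /= ax eqxx.
  move=> [a|] [b|] //=; first by move/f_out/val_inj ->.
    by move/f_x.
  by move/esym/f_x.
have g_adj : {homo g : a b / adj a b}.
  have f_xadj b : adj x b || adj y b -> f x != f b -> adj (f x) (f b).
    by case/orP=> /f_adj; rewrite ?fxy.
  move=> a b /andP[ab]; move: (ab); rewrite -(inj_eq g_inj).
  case: a b ab => [a|] [b|] _ //= gab.
  - by rewrite [X in _ || X]adj_sym orbb => /f_adj; apply.
  - by move=> /f_xadj h; rewrite adj_sym h // eq_sym.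
  - by rewrite orbF => /f_xadj; apply.
exists (fun a => B (g a)); split=> [a|a b ab|a|a b /g_adj/Badj //].
- exact: B0.
- by apply: Bdisj; rewrite (inj_eq g_inj).
- exact: Bconn.
Qed.

(** * Certificates for minors *)

Section Certificates.
Variable G : sgraph.

(** A list that exhibits its set of entries as connected, read from the end:
    every entry but the last has a neighbour further down the list. *)
Fixpoint grown (s : seq G) : bool :=
  if s is v :: s' then ((s' == [::]) || has (adj v) s') && grown s' else true.

Lemma grown_connected (s : seq G) : grown s -> connected_in [set v in s].
Proof.
have mono (A A' : {set G}) u v : A \subset A' ->
    connect (fun a b : G => [&& a \in A, b \in A & adj a b]) u v ->
    connect (fun a b : G => [&& a \in A', b \in A' & adj a b]) u v.
  move=> /subsetP sAA'; apply: connect_sub => a b /and3P[aA bA ab].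
  by apply: connect1; rewrite !sAA'.
elim: s => [_ u v|v s IHs /= /andP[v_s /IHs{}IHs]]; first by rewrite inE.
have sub : [set v in s] \subset [set u in v :: s].
  by apply/subsetP => u; rewrite !inE => ->; rewrite orbT.
have v_conn u : u \in s ->
    connect (fun a b : G => [&& a \in [set w in v :: s],
                                b \in [set w in v :: s] & adj a b]) v u.
  case/orP: v_s => [/eqP -> //|/hasP[w ws vw] us].
  apply: connect_trans (mono _ _ _ _ sub (IHs w u _ _)); rewrite ?inE //.
  by apply: connect1; rewrite !inE eqxx ws vw orbT.
have sym : connect_sym (fun a b : G => [&& a \in [set w in v :: s],
                                b \in [set w in v :: s] & adj a b]).
  by apply: sym_connect_sym => a b; rewrite adj_sym andbCA.
move=> a b; rewrite !inE => /predU1P[->|a_s] /predU1P[->|b_s].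
- exact: connect0.
- exact: v_conn.
- by rewrite sym; apply: v_conn.
- by apply: mono sub _; apply: IHs; rewrite inE.
Qed.

Definition linked (s t : seq G) : bool := has (fun u => has (adj u) t) s.

(** [w] lists the branch sets of the vertices [0], ..., [n - 1] of
    [edge_graph n E].  Lists rather than sets make this evaluate quickly. *)
Definition minor_certificate n (E : seq (nat * nat)) (w : seq (seq G)) : bool :=
  [&& size w == n, [::] \notin w, uniq (flatten w), all grown w
    & all (fun e => linked (nth [::] w e.1) (nth [::] w e.2)) E].

Lemma uniq_flatten_nth (w : seq (seq G)) i j v :
  uniq (flatten w) -> v \in nth [::] w i -> v \in nth [::] w j -> i = j.
Proof.
elim: w i j => [|s w IHw] i j; first by rewrite nth_nil.
rewrite /= cat_uniq => /and3P[_ /hasPn s_w w_uniq].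
have N k : v \in s -> v \in nth [::] w k -> False.
  move=> vs vk; have [kw|kw] := ltnP k (size w); last by rewrite nth_default in vk.
  by move: vs; apply/negP/s_w/flattenP; exists (nth [::] w k); rewrite ?mem_nth.
case: i j => [|i] [|j] //=; first by move=> /N h /h.
  by move=> h1 /N /(_ h1).
by move=> vi vj; rewrite (IHw i j).
Qed.

Lemma minor_of_certificate n E (w : seq (seq G)) :
  minor_certificate n E w -> has_minor G (edge_graph n E).
Proof.
case/and5P=> /eqP w_size w_ne w_uniq w_grown w_edges.
have w_mem (x : 'I_n) : nth [::] w x \in w by rewrite mem_nth ?w_size.
exists (fun x : 'I_n => [set v in nth [::] w x]); split=> [x|x y xy|x|x y].
- have: nth [::] w x != [::] by apply: contraNneq w_ne => <-.
  case: (nth _ _ _) => // v s _; apply/set0Pn; exists v.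
  by rewrite inE mem_head.
- apply/pred0Pn => -[v /=]; rewrite !inE => /andP[vx vy].
  by case/eqP: xy; apply: val_inj; apply: uniq_flatten_nth vx vy.
- by apply: grown_connected; apply: (allP w_grown).
- case/andP=> _ /orP[] /(allP w_edges) /= /hasP[u ux /hasP[v vy uv]].
    by exists u, v; rewrite !inE.
  by exists v, u; rewrite !inE adj_sym.
Qed.

End Certificates.

(** * Enumerating monomorphisms *)

Section Embeddings.
Variables (G H : sgraph) (hs : seq H).

(** All ways of mapping the vertices [vs] injectively and edge-preservingly to
    [hs], each as the list of images in the order of [vs].  The vertices are
    placed starting from the end of [vs]. *)
Fixpoint embeddings (vs : seq G) : seq (seq H) :=
  if vs is v :: vs' then
    let ns := [seq u <- vs' | adj v u] in
    flatten [seq [seq w :: t | w <- hs & (w \notin t) &&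
                     all (fun u => adj w (nth w t (index u vs'))) ns]
            | t <- embeddings vs']
  else [:: [::]].

Lemma embeddingsP vs t (h0 : H) : t \in embeddings vs ->
  [/\ size t = size vs, uniq t &
      {in vs &, forall u v, adj u v ->
         adj (nth h0 t (index u vs)) (nth h0 t (index v vs))}].
Proof.
elim: vs t => [|v vs IHvs] t /=; first by rewrite inE => /eqP ->.
case/flattenP=> _ /mapP[s /IHvs[s_size s_uniq s_adj] ->] /mapP[w].
rewrite mem_filter => /andP[/andP[w_s /allP w_adj] _] ->.
split=> /=; [by rewrite s_size | by rewrite w_s | ].
have w_ok u : u \in vs -> adj v u -> adj w (nth h0 s (index u vs)).
  move=> u_vs vu; rewrite (set_nth_default w) ?s_size ?index_mem //.
  by apply: w_adj; rewrite mem_filter vu.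
move=> a b; rewrite !inE !(eq_sym v).
have [->|av] := eqVneq a v; have [->|bv] //= := eqVneq b v.
- by rewrite adj_irrefl.
- by move=> _; apply: w_ok.
- by move=> a_vs _; rewrite adj_sym [adj _ w]adj_sym; apply: w_ok.
- exact: s_adj.
Qed.

Definition apply_embedding (h0 : H) (vs : seq G) (t : seq H) (v : G) : H :=
  nth h0 t (index v vs).

Lemma embeddings_mono (h0 : H) vs t : (forall v, v \in vs) ->
  t \in embeddings vs -> monomorphism (apply_embedding h0 vs t).
Proof.
move=> vs_all /embeddingsP-/(_ h0)[t_size t_uniq t_adj]; split=> u v.
  move/eqP; rewrite nth_uniq ?t_size ?index_mem // => /eqP uv.
  by rewrite -(nth_index u (vs_all u)) uv nth_index.
exact: t_adj.
Qed.

End Embeddings.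

(** * Faces of cubic graphs of girth at least five *)

Lemma next_neq (T : eqType) (s : seq T) (x : T) :
  uniq s -> 1 < size s -> x \in s -> next s x != x.
Proof.
move=> s_uniq s_size xs; have [i t def_s] := rot_to xs.
rewrite -(next_rot i) // def_s; move: s_uniq s_size.
rewrite -(rot_uniq i) -(size_rot i) def_s.
case: t {def_s} => [|y t] //= /andP[]; rewrite inE eqxx => /norP[xy _] _ _.
by rewrite eq_sym.
Qed.

(** On a cyclic order of three elements, either [y] follows [x] or [x] follows
    [y]. *)
Lemma next_size3 (T : eqType) (s : seq T) (x y : T) :
  uniq s -> size s = 3 -> x \in s -> y \in s -> x != y ->
  next s x = y \/ next s y = x.
Proof.
move=> s_uniq s_size xs; have [i t def_s] := rot_to xs.
have next_s z : next s z = next (x :: t) z by rewrite -def_s next_rot.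
rewrite !next_s -(mem_rot i); move: s_uniq s_size.
rewrite -(rot_uniq i) -(size_rot i) def_s {next_s def_s}.
case: t => [|a [|b []]] //=; rewrite !inE !eqxx => /and3P[/norP[xa xb] ab _] _.
rewrite [y == x]eq_sym => /or3P[/eqP ->|/eqP ->|/eqP ->] => [/eqP //||] _.
  by left.
by right; rewrite (negbTE xb) [b == a]eq_sym (negbTE ab) eqxx.
Qed.

Lemma leq_order_traject (T : finType) (f : T -> T) (x : T) n :
  uniq (traject f x n) -> n <= order f x.
Proof.
move=> t_uniq; rewrite -(size_traject f x n) -(size_orbit f x).
apply: uniq_leq_size t_uniq _ => _ /trajectP[i _ ->].
by rewrite -fconnect_orbit fconnect_iter.
Qed.

(** The orbit lengths in [A] sum to [#|A|].  If there are [#|A| / k] orbits,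
    their average length is [k], so a lower bound of [k] on every length is an
    equality. *)
Lemma order_of_fcard (T : finType) (f : T -> T) (A : {set T}) k :
    injective f -> fclosed f A -> {in A, forall x, k <= order f x} ->
    #|A| = fcard f A * k ->
  {in A, forall x, order f x = k}.
Proof.
move=> f_inj A_closed le_k cardA.
have fsym := fconnect_sym f_inj.
have rootA x : (froot f x \in A) = (x \in A).
  by rewrite -(closed_connect A_closed (connect_root _ x)).
pose R := [predI froots f & A].
have sum_order : \sum_(r in R) order f r = \sum_(r in R) k.
  rewrite sum_nat_const [#|R|]/(fcard f A) -cardA -sum1_card; symmetry.
  rewrite (partition_big (froot f) (mem R)) => [|x xA]; last first.
    by rewrite !inE rootA xA roots_root.
  apply: eq_bigr => r /andP[/= /eqP r_root rA].
  rewrite sum1dep_card /order -cardsE; apply: eq_card => x.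
  rewrite !inE -!topredE /= -(root_connect fsym) r_root eq_sym.
  have [xr|] := eqVneq; last by rewrite andbF.
  by rewrite andbT; move: (rootA x); rewrite -xr rA => /esym.
have R_order r : r \in R -> order f r = k.
  move=> rR; apply/eqP; rewrite eqn_leq le_k ?andbT; last by case/andP: rR.
  move: sum_order; rewrite (bigD1 r) //= [RHS](bigD1 r) //= => sum_order.
  rewrite -(leq_add2r (\sum_(i in R | i != r) k)) -sum_order leq_add2l.
  by apply: leq_sum => i /andP[/andP[_ iA] _]; apply: le_k.
move=> x xA; rewrite -(R_order (froot f x)); last by rewrite !inE rootA xA roots_root.
by apply: eq_card => y; rewrite -!topredE /= (same_connect fsym (connect_root _ x)).
Qed.

Section Faces.
Variables (G : sgraph) (M : spherical_embedding G).
Hypothesis cubic : forall v, size (rotation M v) = 3.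
(* Girth at least five, in the form used along a face: a walk with four edges
   that never turns back has no repeated vertex. *)
Hypothesis girth : forall a b c d e : G,
  path (@adj G) a [:: b; c; d; e] -> a != c -> b != d -> c != e ->
  uniq [:: a; b; c; d; e].
Hypothesis card_faces :
  #|darts G| = fcard (face_step (rotation M)) (darts G) * 5.

Local Notation r := (rotation M).
Local Notation f := (face_step r).

Lemma face_step_inj : injective f.
Proof.
move=> [a b] [c d] [] /= <-.
by move/(can_inj (prev_next (rotation_uniq M b))) => ->.
Qed.

Lemma face_step_dart p : p \in darts G -> f p \in darts G.
Proof.
rewrite !inE /= => p_dart.
by rewrite -(mem_rotation M) mem_next mem_rotation adj_sym.
Qed.

Lemma face_step_neq p : p \in darts G -> p.1 != (f p).2.
Proof.
rewrite inE => p_dart; rewrite eq_sym next_neq ?rotation_uniq ?cubic //.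
by rewrite mem_rotation adj_sym.
Qed.

(** A face walk never turns back, so girth five keeps its first five vertices
    distinct. *)
Lemma face_prefix p : p \in darts G ->
  uniq [seq q.1 | q <- traject f p 5].
Proof.
move=> p0; have p1 := face_step_dart p0; have p2 := face_step_dart p1.
have p3 := face_step_dart p2.
have := face_step_neq p2; have := face_step_neq p1; have := face_step_neq p0.
move: p0 p1 p2 p3; rewrite !inE => p0 p1 p2 p3 n0 n1 n2.
by apply: girth => //=; apply/and5P.
Qed.

Lemma face_order : {in darts G, forall p, order f p = 5}.
Proof.
apply: order_of_fcard card_faces; first exact: face_step_inj.
  apply: intro_closed; first exact: fconnect_sym face_step_inj.
  by move=> p _ /eqP <- /face_step_dart.
by move=> p /face_prefix/map_uniq; apply: leq_order_traject.
Qed.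

Lemma facial_cycle_of_dart p : p \in darts G ->
  facial_cycle M [seq q.1 | q <- traject f p 5].
Proof.
move=> pG; split; [by rewrite size_map size_traject | | ]; last first.
  by exists p => //; rewrite /orbit face_order.
rewrite /ucycle face_prefix // andbT.
have : iter 5 f p = p by rewrite -(face_order pG) iter_order //; apply: face_step_inj.
move=> p5.
have p1 := face_step_dart pG; have p2 := face_step_dart p1.
have p3 := face_step_dart p2; have p4 := face_step_dart p3.
(* The walk closes up after five steps, so its fifth dart ends at [p.1]. *)
have a40 : (f (f (f (f p)))).2 = p.1 by rewrite -[p in RHS]p5.
move: pG p1 p2 p3 p4; rewrite !inE a40 => p0 p1 p2 p3 p4.
by apply/and5P; split=> //; rewrite andbT.
Qed.

Lemma facial_cycle_size c : facial_cycle M c -> size c = 5.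
Proof. by case=> _ _ [p pG ->]; rewrite size_map size_orbit face_order. Qed.

Lemma cofacial_adj u v : adj u v ->
  exists2 c, facial_cycle M c & (u \in c) && (v \in c).
Proof.
move=> uv; have uvG : (u, v) \in darts G by rewrite inE.
have cM := facial_cycle_of_dart uvG.
exists [seq q.1 | q <- traject f (u, v) 5] => //.
by rewrite !inE !eqxx ?orbT.
Qed.

(** At [w], one of [u] and [v] follows the other in the rotation, so the face
    that enters [w] from the former leaves it to the latter. *)
Lemma cofacial_common_neighbour u v w : adj w u -> adj w v -> u != v ->
  exists2 c, facial_cycle M c & (u \in c) && (v \in c).
Proof.
move=> wu wv uv; wlog uwv : u v wu wv uv / next (r w) u = v => [gen|].
  have [] := @next_size3 _ (r w) u v; rewrite ?rotation_uniq ?mem_rotation //.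
    exact: gen.
  case/gen; rewrite // 1?eq_sym // => c cM; rewrite andbC => uvc.
  by exists c.
have uwG : (u, w) \in darts G by rewrite inE adj_sym.
have cM := facial_cycle_of_dart uwG.
exists [seq q.1 | q <- traject f (u, w) 5] => //.
by rewrite !inE /= uwv !eqxx ?orbT.
Qed.

End Faces.

(** * The graph [P/e] *)

(** The quotient of the Petersen graph by one edge; vertex [0], of degree four,
    is the image of that edge. *)
Definition Q_edges : seq (nat * nat) :=
  [:: (0, 1); (0, 3); (0, 4); (0, 5); (1, 2); (1, 6); (2, 3); (2, 7); (3, 8);
      (4, 6); (4, 7); (5, 7); (5, 8); (6, 8)].

Definition Q_graph : sgraph := edge_graph 9 Q_edges.

(** A form of the enumeration of ordinals meant for deciding finite statements
    by evaluation. *)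
Definition vertices n : seq 'I_n.+1 := map inZp (iota 0 n.+1).

Lemma mem_vertices n (v : 'I_n.+1) : v \in vertices n.
Proof.
by rewrite -(valZpK v) map_f // mem_iota add0n ltn_ord.
Qed.

Lemma all_vertices n (p : pred 'I_n.+1) : all p (vertices n) -> forall v, p v.
Proof. by move=> /allP p_all v; apply/p_all/mem_vertices. Qed.

Definition pv : nat -> Petersen := @inZp 9.

Definition petersen_order : seq Petersen := rev (map pv (iota 0 10)).

Definition petersen_automorphisms : seq (seq Petersen) :=
  embeddings (vertices 9 : seq Petersen) petersen_order.

Definition petersen_apply : seq Petersen -> Petersen -> Petersen :=
  apply_embedding (pv 0) petersen_order.

Lemma petersen_arc_transitive (x y : Petersen) : adj x y ->
  exists2 s : Petersen -> Petersen,
    monomorphism s & (s x, s y) = (pv 0, pv 1).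
Proof.
pose ok (x y : Petersen) := has (fun t =>
  (petersen_apply t x, petersen_apply t y) == (pv 0, pv 1)) petersen_automorphisms.
have arcs : all (fun x : Petersen =>
    all (fun y : Petersen => adj x y ==> ok x y) (vertices 9)) (vertices 9).
  by vm_compute.
move=> xy; have /hasP[t t_aut /eqP txy] : ok x y.
  by move: xy; apply/implyP; move: y; apply: all_vertices; move: x; apply: all_vertices.
exists (petersen_apply t); last exact: txy.
apply: embeddings_mono t_aut.
by apply: (@all_vertices 9 (mem petersen_order)); vm_compute.
Qed.

(** Shifts every vertex down by one, except that [0] and [1] are both sent to
    [0]: this is the contraction of the edge [01]. *)
Definition petersen_contraction (a : Petersen) : Q_graph := @inZp 8 (val a).-1.

(** Composing the contraction of [01] with a symmetry that carries the arc
    [xy] to [01] identifies [x] and [y] and nothing else. *)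
Lemma contract_petersen_minor (G : sgraph) (x y : Petersen) :
  adj x y -> has_minor G Q_graph -> has_minor G (contract x y).
Proof.
move=> xy; have [s [s_inj s_adj] [sx sy]] := petersen_arc_transitive xy.
have f_ok (a b : Petersen) :
    ((a != b) && (petersen_contraction a == petersen_contraction b) ==>
       (a \in [:: pv 0; pv 1])) &&
    (adj a b && (petersen_contraction a != petersen_contraction b) ==>
       adj (petersen_contraction a) (petersen_contraction b)).
  move: b; apply: all_vertices; move: a; apply: (@all_vertices 9 (fun a => all _ _)).
  by vm_compute.
apply: (@contract_minor _ _ _ _ _ (petersen_contraction \o s)) => /=
  [|a b ab fab|a b ab fab].
- by rewrite sx sy; apply/eqP.
- have /andP[/implyP + _] := f_ok (s a) (s b).
  by rewrite (inj_eq s_inj) ab fab eqxx -sx -sy !inE !(inj_eq s_inj); apply.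
- by have /andP[_ /implyP] := f_ok (s a) (s b); apply; rewrite s_adj.
Qed.

Lemma petersen_minor : has_minor Petersen Q_graph.
Proof.
pose w : seq (seq Petersen) := map (map (@inZp 9))
  [:: [:: 6; 1]; [:: 0]; [:: 5]; [:: 8]; [:: 9]; [:: 2]; [:: 4]; [:: 7]; [:: 3]].
by apply: (@minor_of_certificate _ 9 Q_edges w); vm_compute.
Qed.

Lemma triplex_minor : has_minor Triplex Q_graph.
Proof.
pose w : seq (seq Triplex) := map (map (@inZp 11))
  [:: [:: 11; 2]; [:: 1; 0]; [:: 9]; [:: 3]; [:: 8; 7]; [:: 5]; [:: 10];
      [:: 6]; [:: 4]].
by apply: (@minor_of_certificate _ 9 Q_edges w); vm_compute.
Qed.

Lemma basket_minor : has_minor Basket Q_graph.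
Proof.
pose w : seq (seq Basket) := map (map (@inZp 11))
  [:: [:: 7; 6; 5; 4]; [:: 1]; [:: 0]; [:: 2]; [:: 8]; [:: 9]; [:: 3];
      [:: 10]; [:: 11]].
by apply: (@minor_of_certificate _ 9 Q_edges w); vm_compute.
Qed.

(** * The dodecahedron *)

Definition dv : nat -> Dodecahedron := @inZp 19.

Definition neighbours (v : Dodecahedron) : seq Dodecahedron :=
  [seq u <- vertices 19 | adj v u].

Lemma mem_neighbours u v : (u \in neighbours v) = adj v u.
Proof. by rewrite mem_filter mem_vertices andbT. Qed.

Definition dist_le2 (u v : Dodecahedron) : bool :=
  [|| u == v, adj u v | has (adj v) (neighbours u)].

Lemma dodecahedron_cubic (v : Dodecahedron) : size (neighbours v) = 3.
Proof.
by apply/eqP; move: v; apply: all_vertices; vm_compute.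
Qed.

Lemma dodecahedron_girth (a b c d e : Dodecahedron) :
  path (@adj Dodecahedron) a [:: b; c; d; e] ->
  a != c -> b != d -> c != e -> uniq [:: a; b; c; d; e].
Proof.
have walks : all (fun a => all (fun b => all (fun c => all (fun d => all (fun e =>
    [&& a != c, b != d & c != e] ==> uniq [:: a; b; c; d; e])
    (neighbours d)) (neighbours c)) (neighbours b)) (neighbours a)) (vertices 19).
  by vm_compute.
move=> /and5P[ab bc cd de _] ac bd ce.
have := all_vertices walks a; rewrite -!mem_neighbours in ab bc cd de.
move=> /allP/(_ b ab)/allP/(_ c bc)/allP/(_ d cd)/allP/(_ e de)/implyP.
by apply; rewrite ac bd.
Qed.

(** Ordered for the search: from the end, each new vertex after the first is
    adjacent to an earlier one, and faces are closed up early, which keeps the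
    number of partial maps at most 240. *)
Definition dodecahedron_order : seq Dodecahedron := map dv
  [:: 6; 5; 7; 15; 17; 16; 4; 14; 18; 8; 13; 3; 19; 11; 12; 10; 9; 2; 1; 0].

Definition dodecahedron_automorphisms : seq (seq Dodecahedron) :=
  embeddings (vertices 19 : seq Dodecahedron) dodecahedron_order.

Definition dodecahedron_apply : seq Dodecahedron -> Dodecahedron -> Dodecahedron :=
  apply_embedding (dv 0) dodecahedron_order.

Lemma dodecahedron_apply_mono t :
  t \in dodecahedron_automorphisms -> monomorphism (dodecahedron_apply t).
Proof.
apply: embeddings_mono.
by apply: (@all_vertices 19 (mem dodecahedron_order)); vm_compute.
Qed.

(** The images of the sequences [bs] under those automorphisms that carry [0]
    to [u].  All base sequences used below start with [0], so fixing [u] loses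
    nothing and leaves only six automorphisms to go through. *)
Definition images (bs : seq (seq Dodecahedron)) (u : Dodecahedron) :
    seq (seq Dodecahedron) :=
  [seq map (dodecahedron_apply t) b
     | t <- [seq t <- dodecahedron_automorphisms | dodecahedron_apply t (dv 0) == u],
       b <- bs].

Lemma imagesP bs u c : c \in images bs u ->
  exists2 b, b \in bs & exists2 s : Dodecahedron -> Dodecahedron,
    monomorphism s & c = map s b.
Proof.
(* Abstracting the list of automorphisms keeps unification from evaluating it. *)
rewrite /images.
move: dodecahedron_automorphisms dodecahedron_apply_mono => auts auts_mono.
case/allpairsP=> -[t b] [+ bP ->]; rewrite mem_filter => /andP[_ /auts_mono t_mono].
by exists b => //; exists (dodecahedron_apply t).
Qed.

Section DodecahedronFaces.
Variable M : spherical_embedding Dodecahedron.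

Lemma rotation_dodecahedron v : size (rotation M v) = 3.
Proof.
rewrite -(dodecahedron_cubic v); apply/perm_size/uniq_perm.
- exact: rotation_uniq.
- by apply/filter_uniq; vm_compute.
- by move=> u; rewrite mem_rotation mem_neighbours.
Qed.

Lemma card_faces_dodecahedron :
  #|darts Dodecahedron| = fcard (face_step (rotation M)) (darts Dodecahedron) * 5.
Proof.
(* Euler's formula reads 20 + F = 30 + 2. *)
have := embedding_euler M; rewrite DodecahedronEmbedding.card_d card_ord.
by move=> /(@addnI 20 _ 12) ->.
Qed.

End DodecahedronFaces.

(** * Jump extensions *)

(** One pair at each of the distances 3, 4 and 5. *)
Definition far_bases : seq (seq Dodecahedron) :=
  [:: [:: dv 0; dv 3]; [:: dv 0; dv 4]; [:: dv 0; dv 5]].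

(** The dodecahedron is distance-transitive, and its diameter is 5. *)
Lemma far_transitive (u v : Dodecahedron) :
  ~~ dist_le2 u v -> [:: u; v] \in images far_bases u.
Proof.
have pairs : all (fun u =>
    let ps := images far_bases u in all (fun v => [:: u; v] \in ps)
      [seq v <- vertices 19 | ~~ dist_le2 u v])
    (vertices 19 : seq Dodecahedron) by vm_compute.
move=> uv; have /allP := all_vertices pairs u; apply.
by rewrite mem_filter mem_vertices andbT.
Qed.

Lemma far_pair_minor (u v : Dodecahedron) :
  ~~ dist_le2 u v -> has_minor (add_edge u v) Q_graph.
Proof.
move=> /far_transitive/imagesP[b b_base [s s_mono def_uv]].
suff: has_minor (add_edge (nth u b 0) (nth v b 1)) Q_graph.
  move: b_base def_uv; rewrite !inE => /or3P[] /eqP -> [-> ->] /=;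
    exact: has_minor_mono (add_edge_mono _ _ s_mono).
move: b_base {def_uv}; rewrite !inE => /or3P[] /eqP -> /=.
- pose w : seq (seq (add_edge (dv 0) (dv 3))) := map (map (@inZp 19))
    [:: [:: 18; 8]; [:: 16; 6]; [:: 13; 15; 5]; [:: 17; 7]; [:: 10]; [:: 9];
        [:: 14; 12; 2; 1]; [:: 4; 3; 0]; [:: 19; 11]].
  by apply: (@minor_of_certificate _ 9 Q_edges w); vm_compute.
- pose w : seq (seq (add_edge (dv 0) (dv 4))) := map (map (@inZp 19))
    [:: [:: 4; 0]; [:: 13; 15; 5]; [:: 17; 19; 11; 1]; [:: 9]; [:: 16; 14];
        [:: 18; 10]; [:: 7; 6]; [:: 12; 3; 2]; [:: 8]].
  by apply: (@minor_of_certificate _ 9 Q_edges w); vm_compute.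
- pose w : seq (seq (add_edge (dv 0) (dv 5))) := map (map (@inZp 19))
    [:: [:: 5; 0]; [:: 2; 1]; [:: 19; 11]; [:: 18; 9; 8]; [:: 15]; [:: 6];
        [:: 13; 3]; [:: 17; 7]; [:: 16; 10; 12; 14; 4]].
  by apply: (@minor_of_certificate _ 9 Q_edges w); vm_compute.
Qed.

Lemma jump_extension_minor (M : spherical_embedding Dodecahedron) (G : sgraph) :
  jump_extension M G -> has_minor G Q_graph.
Proof.
move=> [u [v [uv uv_far ->]]].
have cubic := rotation_dodecahedron M.
have faces := card_faces_dodecahedron M.
have [|/far_pair_minor //] := boolP (dist_le2 u v).
case/or3P=> [/eqP uv_eq|uv_adj|/hasP[w wu vw]].
- by rewrite uv_eq eqxx in uv.
- have [c cM /andP uvc] := cofacial_adj cubic dodecahedron_girth faces uv_adj.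
  by case: (uv_far c cM).
- rewrite mem_neighbours adj_sym in wu; rewrite adj_sym in vw.
  have [c cM /andP uvc] :=
    cofacial_common_neighbour cubic dodecahedron_girth faces wu vw uv.
  by case: (uv_far c cM).
Qed.

(** * Cross extensions *)

Definition pentagon_base : seq Dodecahedron := map dv [:: 0; 1; 2; 12; 10].

(** The dodecahedron has 12 5-cycles, hence 120 when each is given a starting
    point and a direction, and its 120 automorphisms permute these simply
    transitively.  A closed walk of length five in a graph of girth five is
    automatically a cycle. *)
Lemma pentagon_transitive (a b c d e : Dodecahedron) :
  cycle (@adj Dodecahedron) [:: a; b; c; d; e] ->
  exists2 s : Dodecahedron -> Dodecahedron,
    monomorphism s & [:: a; b; c; d; e] = map s pentagon_base.
Proof.
have walks : all (fun a => let ps := images [:: pentagon_base] a in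
    all (fun b => all (fun c => all (fun d => all (fun e =>
    [:: a; b; c; d; e] \in ps)
    [seq e <- neighbours d | adj e a])
    (neighbours c)) (neighbours b)) (neighbours a)) (vertices 19).
  by vm_compute.
move=> /and5P[ab bc cd de /andP[ea _]].
suff /imagesP[p] : [:: a; b; c; d; e] \in images [:: pentagon_base] a.
  by rewrite inE => /eqP ->.
have := all_vertices walks a; rewrite -!mem_neighbours in ab bc cd de.
move=> /allP/(_ b ab)/allP/(_ c bc)/allP/(_ d cd)/allP; apply.
by rewrite mem_filter ea.
Qed.

Lemma pentagon_cross_minor (a b c d e : Dodecahedron) :
  cycle (@adj Dodecahedron) [:: a; b; c; d; e] ->
  has_minor (add_edges2 a c b d) Q_graph.
Proof.
move=> /pentagon_transitive[s s_mono [-> -> -> -> _]].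
apply: has_minor_mono (add_edges2_mono _ _ _ _ s_mono) _.
pose w : seq (seq (add_edges2 (dv 0) (dv 2) (dv 1) (dv 12))) := map (map (@inZp 19))
  [:: [:: 18; 17; 16; 15; 8; 7; 6; 5]; [:: 14; 4]; [:: 12]; [:: 10];
      [:: 13]; [:: 19]; [:: 3; 2]; [:: 11; 1]; [:: 9; 0]].
by apply: (@minor_of_certificate _ 9 Q_edges w); vm_compute.
Qed.

(** Moving the first end [u1] to the last place leaves the cross unchanged. *)
Lemma cross_rot_minor (G K : sgraph) (u1 u2 v1 v2 : G) :
  has_minor (add_edges2 u1 v1 u2 v2) K -> has_minor (add_edges2 u2 v2 v1 u1) K.
Proof.
apply: (@has_minor_mono (add_edges2 u1 v1 u2 v2) (add_edges2 u2 v2 v1 u1) K id).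
split=> // x y.
rewrite /= /sym_rel /= /sym_rel !(eq_sym y) => /andP[/= -> /=].
by do ![case: (_ == _) | case: (adj _ _)].
Qed.

Lemma cross_extension_minor (M : spherical_embedding Dodecahedron) (G : sgraph) :
  cross_extension M G -> has_minor G Q_graph.
Proof.
move=> [c [u1 [u2 [v1 [v2 [cM _ q_c ->]]]]]].
have c_size := facial_cycle_size (rotation_dodecahedron M) dodecahedron_girth
  (card_faces_dodecahedron M) cM.
case: cM => _ /andP[c_cycle _] _.
have minor k x y z t w : rot k c = [:: x; y; z; t; w] ->
    has_minor (add_edges2 x z y t) Q_graph.
  by move=> def_c; apply: (@pentagon_cross_minor x y z t w); rewrite -def_c rot_cycle.
(* Reading the pentagon from just after the vertex outside the cross turns the
   ends of the cross into a rotation of its first four vertices. *)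
case: c c_size q_c minor {c_cycle} => [|a [|b [|c [|d [|e [|? ?]]]]]] // _.
move=> /subseqP[m m_size def_q] minor; move: m_size def_q.
case: m => [|m1 [|m2 [|m3 [|m4 [|m5 []]]]]] // _.
case: m1 m2 m3 m4 m5 => [] [] [] [] [] //= -[-> -> -> ->].
- exact: (minor 0).
- by apply: cross_rot_minor; apply: (minor 4).
- by do 2!apply: cross_rot_minor; apply: (minor 3).
- by do 3!apply: cross_rot_minor; apply: (minor 2).
- exact: (minor 1).
Qed.

(** * The five containments *)

Theorem lemma3p2 (x y : Petersen) (xy : adj x y) :
  let Q := contract x y in
  [/\ has_minor Petersen Q,
      has_minor Triplex Q,
      has_minor Basket Q,
      forall (M : spherical_embedding Dodecahedron) (G : sgraph),
        jump_extension M G -> has_minor G Q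
    & forall (M : spherical_embedding Dodecahedron) (G : sgraph),
        cross_extension M G -> has_minor G Q].
Proof.
move=> Q; have Q_minor G := @contract_petersen_minor G x y xy.
split; try apply: Q_minor.
- exact: petersen_minor.
- exact: triplex_minor.
- exact: basket_minor.
- by move=> M G /jump_extension_minor/Q_minor.
- by move=> M G /cross_extension_minor/Q_minor.
Qed.
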